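(* Let $0 < \theta < 1/4$ and let $c_2 > 0$. Then for all sufficiently large real $x$ there is no integer $n$ admitting two factorizations $n = a_1 b_1 = a_2 b_2$ with integers $a_1 < a_2 \leq b_2 < b_1$ all lying in the interval $[x^{1/2} - c_2 x^\theta, x^{1/2} + c_2 x^\theta]$. Consequently $g(\theta)$ does not exist: there is no exponent $\gamma$ and no constants $c_1, c_2 > 0$ such that every interval $[x - c_1 x^{\gamma}, x + c_1 x^{\gamma}]$ (for all sufficiently large $x$) contains such an integer $n$.
   Context: For $0 \leq \theta < 1/2$, $g(\theta)$ denotes the least (infimum) exponent $\gamma$ for which there exist constants $c_1, c_2 > 0$ (possibly depending on $\theta$) such that, for all sufficiently large real $x$, the interval $[x - c_1 x^{\gamma}, x + c_1 x^{\gamma}]$ contains an integer $n$ with $n = a_1 b_1 = a_2 b_2$, where $a_1 < a_2 \leq b_2 < b_1$ are integers in the interval $[x^{1/2} - c_2 x^\theta, x^{1/2} + c_2 x^\theta]$. ''$g(\theta)$ does not exist'' means that no such exponent $\gamma$ exists. *)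

(* Defs.v *)
From Stdlib Require Import Reals ZArith.
Open Scope R_scope.

(* [Rpower x y] is the real power only for x > 0; below it always occurs under
   "for all sufficiently large x", so its values at x <= 0 are irrelevant. *)
Definition near_sqrt (theta c2 x : R) (m : Z) : Prop :=
  sqrt x - c2 * Rpower x theta <= IZR m <= sqrt x + c2 * Rpower x theta.

Definition two_close_factorizations (theta c2 x : R) (n : Z) : Prop :=
  exists a1 b1 a2 b2 : Z,
    (n = a1 * b1)%Z /\ (n = a2 * b2)%Z /\
    (a1 < a2)%Z /\ (a2 <= b2)%Z /\ (b2 < b1)%Z /\
    near_sqrt theta c2 x a1 /\ near_sqrt theta c2 x b1 /\
    near_sqrt theta c2 x a2 /\ near_sqrt theta c2 x b2.

(* The exponents gamma whose infimum is g(theta). *)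
Definition g_admissible (theta gamma : R) : Prop :=
  exists c1 c2 : R, 0 < c1 /\ 0 < c2 /\
    exists X : R, forall x : R, X <= x ->
      exists n : Z,
        x - c1 * Rpower x gamma <= IZR n <= x + c1 * Rpower x gamma /\
        two_close_factorizations theta c2 x n.

(* By convention g(theta) exists when the infimum is over a nonempty set. *)
Definition g_exists (theta : R) : Prop :=
  exists gamma : R, g_admissible theta gamma.

(* Main.v *)
Require Import Defs.
From Stdlib Require Import Reals ZArith Lra Lia.
Open Scope R_scope.

(** With [s = a + b] and [d = b - a] one has [s^2 - d^2 = 4 n] for both
    factorizations, so [(s1 - s2) (s1 + s2) = d1^2 - d2^2 > 0] and [s1 - s2 >= 1].
    Hence [s1 + s2 <= d1^2].  The left side is about [4 x^(1/2)], whereas the right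
    side is at most [4 c2^2 x^(2 theta)], which is smaller once [theta < 1/4]. *)

Lemma sum_le_square_gap (a1 b1 a2 b2 : Z) :
  (0 < a1)%Z -> (a1 < a2)%Z -> (a2 <= b2)%Z -> (b2 < b1)%Z ->
  (a1 * b1 = a2 * b2)%Z ->
  (a1 + b1 + a2 + b2 <= (b1 - a1) * (b1 - a1))%Z.
Proof.
  intros Ha1 Ha Hab Hb Heq.
  assert (Hsq : ((a1 + b1 - (a2 + b2)) * (a1 + b1 + a2 + b2)
                 = (b1 - a1) * (b1 - a1) - (b2 - a2) * (b2 - a2))%Z) by nia.
  (* The interval from [a2] to [b2] lies strictly inside the one from [a1] to [b1]. *)
  assert (Hd : ((b2 - a2) * (b2 - a2) < (b1 - a1) * (b1 - a1))%Z) by nia.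
  assert (Hs : (1 <= a1 + b1 - (a2 + b2))%Z) by nia.
  nia.
Qed.

Lemma Rpower_eventually_ge (d M : R) :
  0 < d -> 0 < M -> forall x : R, Rpower M (/ d) <= x -> M <= Rpower x d.
Proof.
  intros Hd HM x Hx.
  (* Write [M] as [(M^(1/d))^d] and use monotonicity in the base. *)
  rewrite <- (Rpower_1 M HM) at 1.
  replace 1 with (/ d * d) by (field; lra).
  rewrite <- Rpower_mult.
  apply Rle_Rpower_l; [lra | split; [apply exp_pos | exact Hx]].
Qed.

Lemma no_two_close_factorizations (theta c2 : R) :
  theta < 1 / 4 -> 0 < c2 ->
  exists X : R, forall x : R, X <= x ->
    ~ (exists n : Z, two_close_factorizations theta c2 x n).
Proof.
  intros Htheta Hc2.
  (* The bound 1 gives [x^(1/4) >= 1]; the other gives [2 c2 <= x^(1/4 - theta)], that is [2 w <= t]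
     below. *)
  exists (Rmax 1 (Rpower (2 * c2) (/ (1 / 4 - theta)))).
  intros x Hx (n & a1 & b1 & a2 & b2 & Hn1 & Hn2 & Ha & Hab & Hb & Na1 & Nb1 & Na2 & Nb2).
  unfold near_sqrt in *.
  assert (Hx1 : 1 <= x) by (eapply Rle_trans; [apply Rmax_l | exact Hx]).
  assert (Hgap : 2 * c2 <= Rpower x (1 / 4 - theta)).
  { apply Rpower_eventually_ge; [lra | lra |].
    eapply Rle_trans; [apply Rmax_r | exact Hx]. }
  set (t := Rpower x (1 / 4)).
  assert (Ht : 1 <= t).
  { unfold t; rewrite <- (Rpower_O x) at 1 by lra; apply Rle_Rpower; lra. }
  assert (Hsqrt : sqrt x = t * t).
  { unfold t; rewrite <- Rpower_plus, <- Rpower_sqrt by lra; f_equal; lra. }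
  set (w := c2 * Rpower x theta) in *.
  assert (Hw : 2 * w <= t).
  { replace t with (Rpower x (1 / 4 - theta) * Rpower x theta)
      by (unfold t; rewrite <- Rpower_plus; f_equal; lra).
    assert (0 < Rpower x theta) by apply exp_pos.
    unfold w; nra. }
  assert (Hw0 : 0 < w) by (apply Rmult_lt_0_compat; [lra | apply exp_pos]).
  rewrite Hsqrt in Na1, Nb1, Na2, Nb2.
  (* From here only [1 <= t], [0 < w] and [2 w <= t] matter: the rest is polynomial in [t] and
     [w]. *)
  clearbody t w.
  assert (Htt : t <= t * t) by nra.
  assert (Ha1 : (0 < a1)%Z) by (apply lt_IZR; lra).
  assert (Hsum : (a1 + b1 + a2 + b2 <= (b1 - a1) * (b1 - a1))%Z)
    by (apply sum_le_square_gap; lia).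
  apply IZR_le in Hsum.
  rewrite mult_IZR, !plus_IZR, !minus_IZR in Hsum.
  assert (Hba : IZR a1 < IZR b1) by (apply IZR_lt; lia).
  assert (Hsquare : (IZR b1 - IZR a1) * (IZR b1 - IZR a1) <= (2 * w) * (2 * w))
    by (apply Rmult_le_compat; lra).
  (* The four factors sum to at least [4 t^2 - 4 w >= 4 t^2 - 2 t >= 2 t^2], yet [Hsum] and
     [Hsquare] bound the sum by [4 w^2 <= t^2]. *)
  nra.
Qed.

Theorem theorem1 (theta : R) (htheta0 : 0 < theta) (htheta1 : theta < 1 / 4) :
  (forall c2 : R, 0 < c2 ->
     exists X : R, forall x : R, X <= x ->
       ~ (exists n : Z, two_close_factorizations theta c2 x n))
  /\ ~ g_exists theta.
Proof.
  split.
  - intros c2 Hc2; exact (no_two_close_factorizations theta c2 htheta1 Hc2).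
  - intros (gamma & c1 & c2 & _ & Hc2 & X & HX).
    destruct (no_two_close_factorizations theta c2 htheta1 Hc2) as [Y HY].
    (* A single point beyond both thresholds suffices for the contradiction. *)
    destruct (HX (Rmax X Y) (Rmax_l X Y)) as (n & _ & Hn).
    apply (HY (Rmax X Y) (Rmax_r X Y)); exists n; exact Hn.
Qed.
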